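(* Let $n\ge 2$. The virtual braid group $VB_n$ has the following reduced presentation, with generators $\sigma_1, v_1,\ldots,v_{n-1}$ (the elements of $VB_n$ of the same names) and defining relations: $$\begin{array}{l} v_i v_{i+1} v_i = v_{i+1} v_i v_{i+1},\\ v_i v_j = v_j v_i,\quad j\neq i\pm 1,\\ v_i^2 = 1,\quad 1\le i\le n-1,\\ \sigma_1 v_j = v_j\sigma_1,\quad j>2,\\ (v_1\sigma_1 v_1)(v_2\sigma_1 v_2)(v_1\sigma_1 v_1) = (v_2\sigma_1 v_2)(v_1\sigma_1 v_1)(v_2\sigma_1 v_2),\\ \sigma_1(v_2v_3v_1v_2\sigma_1v_2v_1v_3v_2) = (v_2v_3v_1v_2\sigma_1v_2v_1v_3v_2)\sigma_1. \end{array}$$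
   Context: The virtual braid group $VB_n$ is the group with generators $\sigma_1,\ldots,\sigma_{n-1}$ (braid generators) and $v_1,\ldots,v_{n-1}$ (virtual generators) and the following relations: braid relations $\sigma_i\sigma_{i+1}\sigma_i=\sigma_{i+1}\sigma_i\sigma_{i+1}$ and $\sigma_i\sigma_j=\sigma_j\sigma_i$ for $|i-j|\ge 2$; virtual relations $v_i^2=1$, $v_iv_{i+1}v_i=v_{i+1}v_iv_{i+1}$, and $v_iv_j=v_jv_i$ for $|i-j|\ge 2$; mixed relations $\sigma_iv_j=v_j\sigma_i$ for $|i-j|\ge 2$ and $v_i\sigma_{i+1}v_i=v_{i+1}\sigma_iv_{i+1}$. In $VB_n$ the other braid generators are expressed through the generators of the reduced presentation by $$\sigma_{i+1} = (v_i\cdots v_2v_1)(v_{i+1}\cdots v_3v_2)\,\sigma_1\,(v_2v_3\cdots v_{i+1})(v_1v_2\cdots v_i),\qquad 1\le i\le n-2.$$ In every presentation, a relation is included exactly when all indices occurring in it lie in $\{1,\ldots,n-1\}$. *)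

(* Defs.v *)
From HB Require Import structures.
From mathcomp Require Import all_boot.
From mathcomp Require Import boolp.

Set Implicit Arguments.
Unset Strict Implicit.
Unset Printing Implicit Defensive.

Import Algebra.

(* The letter (x, false) stands for the generator x, and (x, true) for its
   formal inverse. *)
Definition word (X : Type) := seq (X * bool).

Definition inv_letter X (l : X * bool) : X * bool := (l.1, ~~ l.2).
Definition inv_word X (w : word X) : word X := rev (map (@inv_letter X) w).

(* The congruence on words generated by free cancellation and the relations
   w1 = w2 such that [R w1 w2]; two words are related exactly when they represent
   the same element of < X | R >. *)
Inductive pres_eq X (R : word X -> word X -> Prop) : word X -> word X -> Prop :=
| pres_refl w : pres_eq R w w
| pres_sym w1 w2 : pres_eq R w1 w2 -> pres_eq R w2 w1
| pres_trans w1 w2 w3 : pres_eq R w1 w2 -> pres_eq R w2 w3 -> pres_eq R w1 w3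
| pres_cat u1 u2 w1 w2 :
    pres_eq R u1 u2 -> pres_eq R w1 w2 -> pres_eq R (u1 ++ w1) (u2 ++ w2)
| pres_cancel l : pres_eq R [:: l; inv_letter l] [::]
| pres_rel w1 w2 : R w1 w2 -> pres_eq R w1 w2.

Lemma inv_letterK X : involutive (@inv_letter X).
Proof. by case=> x b; rewrite /inv_letter /= negbK. Qed.

Lemma inv_wordK X : involutive (@inv_word X).
Proof.
by move=> w; rewrite /inv_word map_rev revK -map_comp -[RHS]map_id;
   apply: eq_map => l /=; rewrite inv_letterK.
Qed.

Lemma inv_word_cat X (u w : word X) :
  inv_word (u ++ w) = inv_word w ++ inv_word u.
Proof. by rewrite /inv_word map_cat rev_cat. Qed.

Lemma pres_mulgV X R (w : word X) : pres_eq R (w ++ inv_word w) [::].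
Proof.
elim: w => [|l w IHw]; first exact: pres_refl.
rewrite -cat1s inv_word_cat catA -(catA [:: l]).
apply: (pres_trans (w2 := [:: l] ++ inv_word [:: l])); last exact: pres_cancel.
apply: pres_cat; last exact: pres_refl.
by rewrite -[X in pres_eq _ _ X](cats0 [:: l]); apply: pres_cat IHw;
   exact: pres_refl.
Qed.

Lemma pres_mulVg X R (w : word X) : pres_eq R (inv_word w ++ w) [::].
Proof. by rewrite -{2}(inv_wordK w); exact: pres_mulgV. Qed.

Lemma pres_inv X R (u w : word X) :
  pres_eq R u w -> pres_eq R (inv_word u) (inv_word w).
Proof.
move=> uw; apply: (pres_trans (w2 := inv_word u ++ (w ++ inv_word w))).
  rewrite -[X in pres_eq _ X _]cats0; apply: pres_cat; first exact: pres_refl.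
  exact/pres_sym/pres_mulgV.
rewrite catA -[X in pres_eq _ _ X]cat0s; apply: pres_cat; last exact: pres_refl.
apply: pres_trans (pres_mulVg R u).
by apply: pres_cat (pres_sym uw); exact: pres_refl.
Qed.

Section PresentedGroup.
Variables (X : choiceType) (R : word X -> word X -> Prop).

Definition pres_eqb (u w : word X) : bool := `[< pres_eq R u w >].

Lemma pres_eqb_refl : reflexive pres_eqb.
Proof. by move=> w; apply/asboolP; exact: pres_refl. Qed.

Lemma pres_eqb_sym : symmetric pres_eqb.
Proof. by move=> u w; apply/asboolP/asboolP; exact: pres_sym. Qed.

Lemma pres_eqb_trans : transitive pres_eqb.
Proof.
by move=> w u v /asboolP uw /asboolP wv; apply/asboolP; exact: pres_trans uw wv.
Qed.

Canonical pres_equiv :=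
  EquivRel pres_eqb pres_eqb_refl pres_eqb_sym pres_eqb_trans.

(* The group < X | R >. *)
Definition presented : Type := {eq_quot pres_equiv}%qT.
HB.instance Definition _ := Choice.on presented.
HB.instance Definition _ := Quotient.on presented.

Definition presented_class (w : word X) : presented := (\pi_presented w)%qT.

Lemma presented_classP (u w : word X) :
  presented_class u = presented_class w <-> pres_eq R u w.
Proof.
split=> [/eqquotP/asboolP//|uw].
by apply/eqquotP/asboolP.
Qed.

Definition presented_one : presented := presented_class [::].
Definition presented_mul (g h : presented) : presented :=
  presented_class (repr g ++ repr h).
Definition presented_inv (g : presented) : presented :=
  presented_class (inv_word (repr g)).

Lemma pres_repr (w : word X) : pres_eq R (repr (presented_class w)) w.
Proof. by apply/presented_classP; rewrite /presented_class reprK. Qed.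

Lemma presented_classK (g : presented) : presented_class (repr g) = g.
Proof. by rewrite /presented_class reprK. Qed.

Lemma presented_mulE (u w : word X) :
  presented_mul (presented_class u) (presented_class w) =
  presented_class (u ++ w).
Proof. by apply/presented_classP; apply: pres_cat; exact: pres_repr. Qed.

Lemma presented_invE (w : word X) :
  presented_inv (presented_class w) = presented_class (inv_word w).
Proof. by apply/presented_classP; apply: pres_inv; exact: pres_repr. Qed.

Lemma presented_mulA : associative presented_mul.
Proof.
move=> f g h.
rewrite -(presented_classK f) -(presented_classK g) -(presented_classK h).
by rewrite !presented_mulE catA.
Qed.

Lemma presented_mul1g : left_id presented_one presented_mul.
Proof. by move=> g; rewrite -(presented_classK g) presented_mulE. Qed.

Lemma presented_mulg1 : right_id presented_one presented_mul.
Proof. by move=> g; rewrite -(presented_classK g) presented_mulE cats0. Qed.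

Lemma presented_mulVg : left_inverse presented_one presented_inv presented_mul.
Proof.
move=> g; rewrite -(presented_classK g) presented_invE presented_mulE.
by apply/presented_classP; exact: pres_mulVg.
Qed.

Lemma presented_mulgV : right_inverse presented_one presented_inv presented_mul.
Proof.
move=> g; rewrite -(presented_classK g) presented_invE presented_mulE.
by apply/presented_classP; exact: pres_mulgV.
Qed.

HB.instance Definition _ := isGroup.Build presented
  presented_mulA presented_mul1g presented_mulg1 presented_mulVg presented_mulgV.

Definition presented_gen (x : X) : presented := presented_class [:: (x, false)].

End PresentedGroup.

(* G has presentation < X | R >, the generator x being the element [f x] of G. *)
Definition has_presentation (G : groupType) (X : choiceType) (f : X -> G)
    (R : word X -> word X -> Prop) : Prop :=
  exists phi : {multiplicative presented R -> G},
    (forall x, phi (presented_gen R x) = f x) /\ bijective phi.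

(* The index set {1, ..., n-1}. *)
Definition gen_index (n : nat) := {i : nat | 0 < i < n}.

Definition far n (i j : gen_index n) : bool :=
  ((val i).+2 <= val j) || ((val j).+2 <= val i).

(* [inl i] is sigma_i and [inr i] is v_i. *)
Definition VB_gen (n : nat) := (gen_index n + gen_index n)%type.

Section VirtualBraidGroup.
Variable n : nat.
Let s (i : gen_index n) : VB_gen n * bool := (inl i, false).
Let v (i : gen_index n) : VB_gen n * bool := (inr i, false).

Inductive VB_rel : word (VB_gen n) -> word (VB_gen n) -> Prop :=
| VB_braid i j : val j = (val i).+1 ->
    VB_rel [:: s i; s j; s i] [:: s j; s i; s j]
| VB_braid_far i j : far i j ->
    VB_rel [:: s i; s j] [:: s j; s i]
| VB_virtual_sq i :
    VB_rel [:: v i; v i] [::]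
| VB_virtual i j : val j = (val i).+1 ->
    VB_rel [:: v i; v j; v i] [:: v j; v i; v j]
| VB_virtual_far i j : far i j ->
    VB_rel [:: v i; v j] [:: v j; v i]
| VB_mixed_far i j : far i j ->
    VB_rel [:: s i; v j] [:: v j; s i]
| VB_mixed i j : val j = (val i).+1 ->
    VB_rel [:: v i; s j; v i] [:: v j; s i; v j].

End VirtualBraidGroup.

Definition VB (n : nat) : groupType := presented (@VB_rel n).
Definition VB_sigma n (i : gen_index n) : VB n := presented_gen (@VB_rel n) (inl i).
Definition VB_v n (i : gen_index n) : VB n := presented_gen (@VB_rel n) (inr i).

(* [inl tt] is sigma_1 and [inr i] is v_i. *)
Definition reduced_gen (n : nat) := (unit + gen_index n)%type.

Section ReducedPresentation.
Variable n : nat.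
Let s : reduced_gen n * bool := (inl tt, false).
Let v (i : gen_index n) : reduced_gen n * bool := (inr i, false).

Inductive reduced_rel : word (reduced_gen n) -> word (reduced_gen n) -> Prop :=
| reduced_virtual i j : val j = (val i).+1 ->
    reduced_rel [:: v i; v j; v i] [:: v j; v i; v j]
| reduced_virtual_comm i j : val j <> (val i).+1 -> val i <> (val j).+1 ->
    reduced_rel [:: v i; v j] [:: v j; v i]
| reduced_virtual_sq i :
    reduced_rel [:: v i; v i] [::]
| reduced_sigma_v j : 2 < val j ->
    reduced_rel [:: s; v j] [:: v j; s]
| reduced_braid i1 i2 : val i1 = 1 -> val i2 = 2 ->
    reduced_rel
      ([:: v i1; s; v i1] ++ [:: v i2; s; v i2] ++ [:: v i1; s; v i1])
      ([:: v i2; s; v i2] ++ [:: v i1; s; v i1] ++ [:: v i2; s; v i2])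
| reduced_braid_far i1 i2 i3 : val i1 = 1 -> val i2 = 2 -> val i3 = 3 ->
    reduced_rel
      (s :: [:: v i2; v i3; v i1; v i2; s; v i2; v i1; v i3; v i2])
      ([:: v i2; v i3; v i1; v i2; s; v i2; v i1; v i3; v i2] ++ [:: s]).

End ReducedPresentation.

Definition gen_index1 n (hn : 2 <= n) : gen_index n := exist _ 1 hn.

Definition reduced_elt n (hn : 2 <= n) (x : reduced_gen n) : VB n :=
  match x with
  | inl _ => VB_sigma (gen_index1 hn)
  | inr i => VB_v i
  end.

(* Main.v *)
From HB Require Import structures.
Require Import Defs.
From mathcomp Require Import all_boot.

Set Implicit Arguments.
Unset Strict Implicit.
Unset Printing Implicit Defensive.

Import Algebra.
Local Open Scope group_scope.

(** The two presentations are related by a Tietze transformation that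
    eliminates sigma_2, ..., sigma_{n-1}.  Since v_i is an involution, the mixed
    relation for (i, i+1) says exactly that
      sigma_{i+1} = sigma_i ^ (v_{i+1} v_i)        (x ^ y = y^-1 x y),
    so in the group of the reduced presentation these words, read recursively
    from sigma_1, are the only possible images of the other braid generators.
    It remains to see that the reduced relations imply the relations of VB_n
    for the elements so obtained; by the universal property of presentations
    ([has_presentation_Tietze]) the homomorphisms in both directions are then
    mutually inverse.

    All the relations involving some sigma_i follow from their instances with
    smallest indices, because conjugation by suitable words in the v_i shifts
    indices by one:
    - sigma_i commutes with v_j for j > i + 1 by induction on i, all factors of
      the word for sigma_i commuting with v_j ([commute_sigma_v_above]);
    - sigma_i commutes with v_j for j < i - 1: the critical case j = i - 2 is
      the conjugate, under a word in the v's taking v_{j+2} to v_j and sigma_j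
      to sigma_{j+2}, of the previous point ([commute_sigma_v_below]);
    - conjugation by v_{i+2} v_{i+1} v_i takes (sigma_i, sigma_{i+1}) to
      (sigma_{i+1}, sigma_{i+2}), which propagates the braid relation from
      i = 1 ([sigma_braid]); conjugation by v_{i+3} v_{i+2} v_{i+1} v_i
      propagates the commutation of sigma_i and sigma_{i+2} from i = 1, and
      the recursive formula for sigma_j gives the commutation of sigma_i and
      sigma_j for j > i + 2 ([commute_sigma]). *)

(** * Homomorphisms out of a presented group *)

Section Multiplicative.
Variables (G H : groupType) (phi : {multiplicative G -> H}).

(** Unlike [gmulf1], [gmulfV] and [gmulfJ], these do not take phi 1 = 1 as part
    of the structure of phi: between groups it follows from multiplicativity. *)
Lemma multiplicative1 : phi 1 = 1.
Proof. by apply: (mulgI (phi 1)); rewrite -gmulfM !mulg1. Qed.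

Lemma multiplicativeV x : phi x^-1 = (phi x)^-1.
Proof.
by apply: (mulgI (phi x)); rewrite -gmulfM !mulgV multiplicative1.
Qed.

Lemma multiplicativeJ x y : phi (x ^ y) = phi x ^ phi y.
Proof. by rewrite !conjgE !gmulfM multiplicativeV. Qed.

End Multiplicative.

Section WordValue.
Variables (X : choiceType) (R : word X -> word X -> Prop) (G : groupType).
Implicit Types (f : X -> G) (u w : word X).

Definition letter_val f (l : X * bool) : G := if l.2 then (f l.1)^-1 else f l.1.

Definition word_val f w : G := \prod_(l <- w) letter_val f l.

Definition respects f := forall u w, R u w -> word_val f u = word_val f w.

Lemma word_val_pres_eq f u w :
  respects f -> pres_eq R u w -> word_val f u = word_val f w.
Proof.
move=> fR; elim=> {u w} // [u v w _ -> _ -> //|u1 u2 w1 w2 _ IHu _ IHw|].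
- by rewrite /word_val !big_cat /= -!/(word_val _ _) IHu IHw.
- case=> x b; rewrite /word_val !big_cons big_nil mulg1 /letter_val /=.
  by case: b; rewrite (mulVg, mulgV).
Qed.

Lemma presented_lift f : respects f ->
  exists phi : {multiplicative presented R -> G},
    forall x, phi (presented_gen R x) = f x.
Proof.
move=> fR; pose phi (g : presented R) := word_val f (repr g).
have phiE w : phi (presented_class R w) = word_val f w.
  by apply: (word_val_pres_eq fR); exact: pres_repr.
have phiM : {morph phi : g h / g * h}.
  by move=> g h; rewrite [LHS]phiE /word_val big_cat.
pose F : {multiplicative presented R -> G} :=
  HB.pack phi (isMultiplicative.Build _ _ phi phiM).
by exists F => x; rewrite [LHS]phiE /word_val big_cons big_nil mulg1.
Qed.

Lemma multiplicative_class (phi : {multiplicative presented R -> G}) w :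
  phi (presented_class R w) = word_val (phi \o presented_gen R) w.
Proof.
elim: w => [|[x b] w IHw]; first by rewrite /word_val big_nil multiplicative1.
have -> : presented_class R ((x, b) :: w) =
    presented_class R [:: (x, b)] * presented_class R w.
  exact/esym/presented_mulE.
rewrite gmulfM IHw /word_val big_cons; congr (_ * _); rewrite /letter_val /=.
case: b => //; rewrite -multiplicativeV; congr (phi _).
by rewrite [RHS]presented_invE.
Qed.

Lemma multiplicative_ext (phi psi : {multiplicative presented R -> G}) :
  (forall x, phi (presented_gen R x) = psi (presented_gen R x)) -> phi =1 psi.
Proof.
move=> eq_gen g; rewrite -(presented_classK g) !multiplicative_class.
by apply: eq_bigr => -[x b] _; rewrite /letter_val /= eq_gen.
Qed.

End WordValue.

Lemma word_val_rel (X : choiceType) (R : word X -> word X -> Prop) u w :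
  R u w -> word_val (presented_gen R) u = word_val (presented_gen R) w.
Proof.
have idE := multiplicative_class (idfun : {multiplicative presented R -> _}).
by move=> uw; rewrite -!idE; apply/presented_classP/pres_rel.
Qed.

Definition word_valE := (big_cons, big_nil, @mulg1, @mulgA).

(** Mutually inverse homomorphisms between two presented groups need to be
    checked on generators only, hence the form of the last two premises: they
    quantify over any homomorphism with the prescribed values, so that no
    homomorphism has to be named before its existence is known. *)
Lemma has_presentation_Tietze (X Y : choiceType)
    (R : word X -> word X -> Prop) (S : word Y -> word Y -> Prop)
    (f : X -> presented S) (g : Y -> presented R) :
  respects R f -> respects S g ->
  (forall psi : {multiplicative presented S -> presented R},
     (forall y, psi (presented_gen S y) = g y) ->
     forall x, psi (f x) = presented_gen R x) ->
  (forall phi : {multiplicative presented R -> presented S},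
     (forall x, phi (presented_gen R x) = f x) ->
     forall y, phi (g y) = presented_gen S y) ->
  has_presentation f R.
Proof.
move=> fR gS gf fg.
have [phi phiE] := presented_lift fR; have [psi psiE] := presented_lift gS.
exists phi; split=> //; exists psi => a.
  apply: (multiplicative_ext (phi := psi \o phi) (psi := idfun)) => x /=.
  by rewrite phiE gf.
apply: (multiplicative_ext (phi := phi \o psi) (psi := idfun)) => y /=.
by rewrite psiE fg.
Qed.

(** * Conjugation and commutation *)

Section Conjugation.
Variable G : groupType.
Implicit Types x y z : G.

Lemma conjg_involution x y : y * y = 1 -> x ^ y = y * x * y.
Proof. by move=> yy; rewrite conjgE (mulg1_eq yy) mulgA. Qed.

Lemma conjg_fixC x y : commute x y -> x ^ y = x.
Proof. by move=> xy; rewrite conjgE xy mulKg. Qed.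

(** A fixed number of factors, because a conjugate is itself a product, into
    which a repeated [conjMg] would distribute. *)
Lemma conjMg3 x y z t : (x * y * z) ^ t = x ^ t * y ^ t * z ^ t.
Proof. by rewrite !conjMg. Qed.

Lemma commute_conjl x y z : commute x z -> commute y z -> commute (x ^ y) z.
Proof.
move=> xz yz; apply/commute_sym.
by rewrite conjgE; do ![apply: commuteM | apply: commuteV]; apply: commute_sym.
Qed.

Lemma commute_conj x y z : commute x y -> commute (x ^ z) (y ^ z).
Proof. by move=> xy; rewrite /commute -!conjMg xy. Qed.

End Conjugation.

(** * The braid generators built from sigma_1 *)

Section RecursiveSigma.
Variables (G : groupType) (n : nat) (v : nat -> G) (s : G).

(** The involution v_i moved across the mixed relation
    v_i sigma_{i+1} v_i = v_{i+1} sigma_i v_{i+1}, read as a definition of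
    sigma_{i+1}.  Indices start at 1; sigma 0 is junk. *)
Fixpoint sigma i := if i is k.+1 then
  if k is _.+1 then (sigma k ^ v i) ^ v k else s else s.

Lemma sigmaS i : 0 < i -> sigma i.+1 = (sigma i ^ v i.+1) ^ v i.
Proof. by case: i. Qed.

Hypothesis vv : forall i, 0 < i < n -> v i * v i = 1.
Hypothesis v_braid : forall i, 0 < i -> i.+1 < n ->
  v i * v i.+1 * v i = v i.+1 * v i * v i.+1.
Hypothesis v_far : forall i j, 0 < i -> i.+1 < j < n -> commute (v i) (v j).

Lemma conjg_vK i (x : G) : 0 < i < n -> (x ^ v i) ^ v i = x.
Proof. by move=> i_n; rewrite -conjgM vv // conjg1. Qed.

Lemma conjg_v_braid i : 0 < i -> i.+1 < n -> v i.+1 ^ v i = v i ^ v i.+1.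
Proof.
move=> i0 i1n; rewrite !conjg_involution ?v_braid ?vv //.
by rewrite i0 ltnW.
Qed.

Hypothesis s_v : forall j, 2 < j < n -> commute s (v j).

Lemma commute_sigma_v_above i j :
  0 < i -> i.+1 < j < n -> commute (sigma i) (v j).
Proof.
elim: i => // -[|i] IHi _ ijn; first exact: s_v.
have [ij jn] := andP ijn; rewrite sigmaS //.
apply: commute_conjl; last by apply: v_far; rewrite // jn (ltnW ij).
apply: commute_conjl; last exact: v_far.
by apply: IHi; rewrite // jn (ltnW ij).
Qed.

(** When i = j + 2, the word for sigma_i contains v_{j+1}, which does not
    commute with v_j.  But sigma_{j+2} is the conjugate of sigma_j by
    v_{j+1} v_j v_{j+2} v_{j+1}, and the same word conjugates v_{j+2} to v_j, so
    the claim becomes the commutation of sigma_j and v_{j+2}. *)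
Lemma commute_sigma_v_below i j :
  0 < j -> j.+1 < i < n -> commute (sigma i) (v j).
Proof.
move=> j0; elim: i => // i IHi /andP[ji i1n].
have i0 : 0 < i by case: i ji {i1n IHi}.
have [eq_i|neq_ij] := eqVneq i j.+1; last first.
  have j1i : j.+1 < i by rewrite ltn_neqAle eq_sym neq_ij.
  rewrite sigmaS //.
  apply: commute_conjl; last by apply/commute_sym/v_far; rewrite // j1i ltnW.
  apply: commute_conjl; last by apply/commute_sym/v_far; rewrite // ltnS ltnW.
  by apply: IHi; rewrite j1i ltnW.
rewrite {i IHi ji i0}eq_i in i1n *; have j1n : j.+1 < n by apply: ltnW.
have jn : j < n by apply: ltnW.
have vj : v j = (((v j.+2 ^ v j.+1) ^ v j) ^ v j.+2) ^ v j.+1.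
  rewrite conjg_v_braid // -(conjgM _ (v j.+2) (v j)) -v_far ?ltnSn //.
  by rewrite conjgM conjg_vK // conjg_v_braid // conjg_vK.
rewrite sigmaS // sigmaS // [in X in commute _ X]vj.
by do 4!apply: commute_conj; apply: commute_sigma_v_above; rewrite // ltnSn.
Qed.

Hypothesis s_braid : 2 < n ->
  s ^ v 1 * s ^ v 2 * s ^ v 1 = s ^ v 2 * s ^ v 1 * s ^ v 2.

Lemma sigma_braid i : 0 < i -> i.+1 < n ->
  sigma i * sigma i.+1 * sigma i = sigma i.+1 * sigma i * sigma i.+1.
Proof.
elim: i => // -[|i] IHi _ i1n.
  (* Conjugation by v_1 turns sigma_2 into sigma_1 ^ v_2. *)
  apply: (conjg_inj (v 1)); rewrite !conjMg3 (sigmaS (i := 1)) // conjg_vK.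
    exact: s_braid.
  exact: ltnW.
(* Conjugation by w shifts the indices of sigma_i and sigma_{i+1} by one. *)
pose w := v i.+3 * v i.+2 * v i.+1.
have sh1 : sigma i.+1 ^ w = sigma i.+2.
  rewrite /w (sigmaS (i := i.+1)) // !conjgM; congr ((_ ^ _) ^ _).
  by apply/conjg_fixC/commute_sigma_v_above; rewrite // ltnSn.
have sh2 : sigma i.+2 ^ w = sigma i.+3.
  rewrite /w !conjgM -sigmaS //; apply: conjg_fixC.
  by apply: commute_sigma_v_below; rewrite // ltnSn.
by rewrite -sh1 -sh2 -!conjMg3 IHi // ltnW.
Qed.

Hypothesis s_braid_far : 3 < n -> commute s ((((s ^ v 2) ^ v 1) ^ v 3) ^ v 2).

Lemma commute_sigma i j : 0 < i -> i.+1 < j < n -> commute (sigma i) (sigma j).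
Proof.
move=> i0; elim: j => // j IHj /andP[ij j1n].
have j0 : 0 < j by case: j ij {IHj j1n}.
have [eq_j|neq_ij] := eqVneq j i.+1; last first.
  have i1j : i.+1 < j by rewrite ltn_neqAle eq_sym neq_ij.
  rewrite sigmaS //; apply/commute_sym.
  apply: commute_conjl; last first.
    by apply/commute_sym/commute_sigma_v_above; rewrite // i1j ltnW.
  apply: commute_conjl; last first.
    by apply/commute_sym/commute_sigma_v_above; rewrite // ltnS (ltnW i1j).
  by apply/commute_sym/IHj; rewrite i1j ltnW.
rewrite {}eq_j in j1n *; elim: i i0 j1n {IHj ij} => // -[|i] IHi _ i3n.
  exact: s_braid_far.
have i2n : i.+3 < n by apply: ltnW.
(* Conjugation by w shifts the indices of sigma_i and sigma_{i+2} by one. *)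
pose w := v i.+4 * v i.+3 * v i.+2 * v i.+1.
have sh1 : sigma i.+1 ^ w = sigma i.+2.
  have fix_v k : i.+2 < k < n -> sigma i.+1 ^ v k = sigma i.+1.
    by move=> ikn; apply/conjg_fixC/commute_sigma_v_above.
  rewrite /w (sigmaS (i := i.+1)) // !conjgM.
  by rewrite (fix_v i.+4) ?(fix_v i.+3) ?ltnSn ?i2n // i3n ltnS leqnSn.
have sh3 : sigma i.+3 ^ w = sigma i.+4.
  have fix_v k : 0 < k < i.+3 -> sigma i.+4 ^ v k = sigma i.+4.
    case/andP=> k0 ki; apply/conjg_fixC/commute_sigma_v_below => //.
    by rewrite ltnS ki.
  by rewrite /w !conjgM -sigmaS // !fix_v ?ltnS /=.
by rewrite -sh1 -sh3; apply: commute_conj; apply: IHi.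
Qed.

End RecursiveSigma.

(** * From the virtual braid group to the reduced presentation *)

Section Extend.
Variables (n : nat) (G : groupType) (f : gen_index n -> G).

(** Indexing by plain natural numbers lets the braid generators be defined and
    studied by recursion on the index; outside {1, ..., n-1} the value is the
    junk value 1, so every relation below carries its bounds. *)
Definition extend i : G := oapp f 1 (insub i).

Lemma extend_val k : extend (val k) = f k.
Proof. by rewrite /extend valK. Qed.

Lemma extendE i (i_n : 0 < i < n) : extend i = f (exist _ i i_n).
Proof.
by rewrite -[i in LHS]/(val (exist _ i i_n : gen_index n)) extend_val.
Qed.

End Extend.

Section ReducedGroup.
Variable n : nat.
Notation G := (presented (@reduced_rel n)).
Let s : G := presented_gen _ (inl tt).
Let v : nat -> G := extend (fun i => presented_gen _ (inr i)).

Let sE : presented_gen (@reduced_rel n) (inl tt) = s. Proof. by []. Qed.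
Let vE i (i_n : 0 < i < n) :
  presented_gen (@reduced_rel n) (inr (exist _ i i_n)) = v i.
Proof. by rewrite /v extendE. Qed.

Lemma reduced_vv i : 0 < i < n -> v i * v i = 1.
Proof.
move=> i_n; have := word_val_rel (reduced_virtual_sq (exist _ i i_n)).
by rewrite /word_val !word_valE /letter_val /= !vE.
Qed.

Lemma reduced_v_braid i : 0 < i -> i.+1 < n ->
  v i * v i.+1 * v i = v i.+1 * v i * v i.+1.
Proof.
move=> i0 i1n; have i_n : 0 < i < n by rewrite i0 ltnW.
have := word_val_rel
  (@reduced_virtual n (exist _ i i_n) (exist _ i.+1 i1n) erefl).
by rewrite /word_val !word_valE /letter_val /= !vE.
Qed.

Lemma reduced_v_far i j : 0 < i -> i.+1 < j < n -> commute (v i) (v j).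
Proof.
move=> i0 /andP[ij jn].
have i_n : 0 < i < n by rewrite i0 (ltn_trans _ jn) // ltnW.
have j_n : 0 < j < n by rewrite jn (leq_trans _ ij).
have := word_val_rel
  (@reduced_virtual_comm n (exist _ i i_n) (exist _ j j_n) _ _).
(* The side conditions say that i and j are not adjacent. *)
rewrite /word_val !word_valE /letter_val /= !vE; apply => /eqP.
  by rewrite gtn_eqF.
by rewrite ltn_eqF // ltnS ltnW // ltnW.
Qed.

Lemma reduced_s_v j : 2 < j < n -> commute s (v j).
Proof.
move=> /andP[j2 jn]; have j_n : 0 < j < n by rewrite jn (ltn_trans _ j2).
have := word_val_rel (@reduced_sigma_v n (exist _ j j_n) j2).
by rewrite /word_val !word_valE /letter_val /= !vE.
Qed.

Lemma reduced_s_braid : 2 < n ->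
  s ^ v 1 * s ^ v 2 * s ^ v 1 = s ^ v 2 * s ^ v 1 * s ^ v 2.
Proof.
move=> n2; have n1 := ltnW n2.
rewrite !conjg_involution ?reduced_vv // !mulgA.
have := word_val_rel
  (@reduced_braid n (exist _ 1%N n1) (exist _ 2 n2) erefl erefl).
by rewrite /word_val !word_valE /letter_val /= !vE sE.
Qed.

Lemma reduced_s_far : 3 < n ->
  commute s ((((s ^ v 2) ^ v 1) ^ v 3) ^ v 2).
Proof.
move=> n3; have n2 := ltnW n3; have n1 := ltnW n2.
rewrite /commute !conjg_involution ?reduced_vv // !mulgA.
have := word_val_rel (@reduced_braid_far n
  (exist _ 1%N n1) (exist _ 2 n2) (exist _ 3 n3) erefl erefl erefl).
by rewrite /word_val !word_valE /letter_val /= !vE sE.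
Qed.

Definition reduced_of_VB_gen (x : VB_gen n) : G :=
  match x with inl i => sigma v s (val i) | inr i => v (val i) end.

Lemma reduced_of_VB_gen_respects : respects (@VB_rel n) reduced_of_VB_gen.
Proof.
have sv_far (i j : gen_index n) :
    far i j -> commute (sigma v s (val i)) (v (val j)).
  rewrite /far; case: i j => i /= i_n [j /= j_n].
  have [[i0 ilt] [j0 jlt]] := (andP i_n, andP j_n).
  case/orP=> ij; last first.
    apply: (commute_sigma_v_below reduced_vv reduced_v_braid reduced_v_far
      reduced_s_v) => //.
    by rewrite ij.
  by apply: (commute_sigma_v_above reduced_v_far reduced_s_v); rewrite ?ij.
have idxS (i j : gen_index n) : val j = (val i).+1 ->
    [/\ 0 < val i, (val i).+1 < n & 0 < val i < n].
  move=> ij; have [/andP[i0 ilt] /andP[_ jlt]] := (valP i, valP j).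
  by split; [|rewrite -ij|apply/andP].
have commute_far (x : nat -> G) :
    (forall i j, 0 < i -> i.+1 < j < n -> commute (x i) (x j)) ->
    forall i j : gen_index n, far i j -> commute (x (val i)) (x (val j)).
  move=> xx i j; have [/andP[ipos ilt] /andP[jpos jlt]] := (valP i, valP j).
  by case/orP=> ij; [|apply/commute_sym]; apply: xx; rewrite ?ij.
have VV := reduced_vv; have VB := reduced_v_braid; have VF := reduced_v_far.
move=> _ _ []; rewrite /word_val.
- move=> i j ij; have [i0 i1n i_n] := idxS i j ij.
  rewrite !word_valE /letter_val /= ij.
  by apply: (sigma_braid VV VB VF reduced_s_v reduced_s_braid).
- move=> i j ij; rewrite !word_valE /letter_val /=.
  apply: commute_far ij => {}i {}j.
  exact: (commute_sigma VV VB VF reduced_s_v reduced_s_far).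
- by move=> i; rewrite !word_valE /letter_val /= VV ?(valP i).
- move=> i j ij; have [i0 i1n i_n] := idxS i j ij.
  by rewrite !word_valE /letter_val /= ij VB.
- move=> i j ij; rewrite !word_valE /letter_val /=.
  exact: commute_far VF _ _ ij.
- move=> i j ij; rewrite !word_valE /letter_val /=.
  exact: sv_far.
- move=> i j ij; have [i0 i1n i_n] := idxS i j ij.
  rewrite !word_valE /letter_val /= ij -!conjg_involution ?VV //.
  by rewrite sigmaS // (conjg_vK VV).
Qed.

End ReducedGroup.

(** * From the reduced presentation to the virtual braid group *)

Section VirtualBraidGroup.
Variable n : nat.
Notation s := (@VB_sigma n).
Notation v := (@VB_v n).

Lemma VB_vv i : v i * v i = 1.
Proof.
have := word_val_rel (VB_virtual_sq i).
by rewrite /word_val !word_valE /letter_val.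
Qed.

Lemma VB_vK x i : (x ^ v i) ^ v i = x.
Proof. by rewrite -conjgM VB_vv conjg1. Qed.

Lemma VB_sigma_far i j : far i j -> commute (s i) (s j).
Proof.
move=> ij; have := word_val_rel (VB_braid_far ij).
by rewrite /word_val !word_valE /letter_val.
Qed.

Lemma VB_v_far i j : far i j -> commute (v i) (v j).
Proof.
move=> ij; have := word_val_rel (VB_virtual_far ij).
by rewrite /word_val !word_valE /letter_val.
Qed.

Lemma VB_sigma_braid i j : val j = (val i).+1 ->
  s i * s j * s i = s j * s i * s j.
Proof.
move=> ij; have := word_val_rel (VB_braid ij).
by rewrite /word_val !word_valE /letter_val.
Qed.

(** The mixed relation, conjugated by the involution v_i: in VB_n the braid
    generators satisfy the recursion that defines [sigma]. *)
Lemma VB_sigmaS i j : val j = (val i).+1 -> s j = (s i ^ v j) ^ v i.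
Proof.
move=> ij; rewrite -[LHS](VB_vK _ i); congr (_ ^ _).
rewrite !conjg_involution ?VB_vv //.
have := word_val_rel (VB_mixed ij).
by rewrite /word_val !word_valE /letter_val.
Qed.

Lemma reduced_elt_respects (hn : 2 <= n) :
  respects (@reduced_rel n) (reduced_elt hn).
Proof.
have gen1 i : val i = 1%N -> VB_sigma (gen_index1 hn) = s i.
  by move=> i1; congr (s _); apply: val_inj.
move=> _ _ []; rewrite /word_val.
- move=> i j ij; rewrite !word_valE /letter_val /=.
  have := word_val_rel (VB_virtual ij).
  by rewrite /word_val !word_valE /letter_val.
- move=> i j nij nji; rewrite !word_valE /letter_val /=.
  have [/val_inj -> //|] := eqVneq (val i) (val j).
  rewrite neq_ltn => neq.
  apply/VB_v_far/orP; case/orP: neq => ij; [left|right].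
    by rewrite ltn_neqAle ij andbT eq_sym; apply/eqP.
  by rewrite ltn_neqAle ij andbT eq_sym; apply/eqP.
- by move=> i; rewrite !word_valE /letter_val /= VB_vv.
- move=> j j2; rewrite !word_valE /letter_val /=.
  have far1j : far (gen_index1 hn) j by rewrite /far j2.
  have := word_val_rel (VB_mixed_far far1j).
  by rewrite /word_val !word_valE /letter_val.
- move=> i1 i2 e1 e2; have e12 : val i2 = (val i1).+1 by rewrite e1 e2.
  rewrite !word_valE /letter_val /= (gen1 i1) //.
  have := VB_sigma_braid e12; rewrite (VB_sigmaS e12).
  move=> /(congr1 (@conjg _ ^~ (v i1))); rewrite !conjMg3 VB_vK.
  by rewrite !conjg_involution ?VB_vv // !mulgA.
- move=> i1 i2 i3 e1 e2 e3.
  have e12 : val i2 = (val i1).+1 by rewrite e1 e2.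
  have e23 : val i3 = (val i2).+1 by rewrite e2 e3.
  rewrite !word_valE /letter_val /= (gen1 i1) //.
  have : commute (s i1) (s i3) by apply: VB_sigma_far; rewrite /far e1 e3.
  rewrite (VB_sigmaS e23) (VB_sigmaS e12) /commute.
  by rewrite !conjg_involution ?VB_vv // !mulgA.
Qed.

End VirtualBraidGroup.

Theorem theorem2 (n : nat) (hn : 2 <= n) :
  has_presentation (@reduced_elt n hn) (@reduced_rel n).
Proof.
apply: (has_presentation_Tietze (reduced_elt_respects hn)
  (@reduced_of_VB_gen_respects n)).
  by move=> psi psiE [[]|i] /=; rewrite psiE //= extend_val.
move=> phi phiE [[i i_n]|i]; last by rewrite /= extend_val phiE.
rewrite /reduced_of_VB_gen [val _]/=; elim: i i_n => // -[_|i IHi] i_n.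
  by rewrite phiE; congr VB_sigma; apply: val_inj.
have i1n : 0 < i.+1 < n by apply: ltnW.
rewrite sigmaS // !multiplicativeJ (IHi i1n) (extendE _ i_n) (extendE _ i1n).
by rewrite !phiE; apply/esym/VB_sigmaS.
Qed.
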